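(* Let $n\ge 1$ and let $\mathbf{w}\in\mathbb{R}^n_{+}$ be a score vector on the items $[n]=\{1,\dots,n\}$ with $\|\mathbf{w}\|_1=\Theta(1)$. Assign to each item $x\in[n]$ the priority $$\mathrm{pri}_x := -\left\lfloor \log_2\log_2 \frac{1}{\mathbf{w}_x}\right\rfloor + \delta_x,\qquad \delta_x\sim U(0,1),$$ where the offsets $\delta_x$ are drawn uniformly from $(0,1)$ via an $11$-wise independent hash function. Let $T$ be the Treap on $[n]$ with these priorities. Then for every item $x\in[n]$, the expected depth of $x$ in $T$ is $O(\log(1/\mathbf{w}_x))$.
   Context: A Treap on $[n]$ with (distinct) priorities $\mathrm{pri}\in\mathbb{R}^n$ is the unique binary search tree $T$ on the ordered keys $[n]$ such that $\mathrm{pri}_x\le \mathrm{pri}_y$ whenever $x$ is a descendant of $y$ (i.e. the root has the largest priority, and the construction recurses on the keys smaller and larger than it). The depth of a node is the number of its ancestors (including itself). The $O(\cdot)$ hides a universal constant independent of $n$, $\mathbf{w}$ and $x$.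
   Formalization: The bound proved is C·max(1, log2(1/w_x)) rather than C·log2(1/w_x), which fails as w_x tends to 1 (depth is at least 1, e.g. n = 1); all scores are taken strictly between 0 and 1 so that the priorities are defined. *)

(* Defs.v *)
From HB Require Import structures.
From mathcomp Require Import all_boot all_order all_algebra.
From mathcomp Require Import all_classical all_reals all_analysis.

Set Implicit Arguments.
Unset Strict Implicit.
Unset Printing Implicit Defensive.

Import Order.TTheory GRing.Theory Num.Theory.

Local Open Scope classical_set_scope.
Local Open Scope ring_scope.

(** Items are ['I_n] = {0, ..., n-1}, ordered as natural numbers. *)

Inductive tree (K : Type) : Type :=
| Leaf
| Node (l : tree K) (k : K) (r : tree K).
Arguments Leaf {K}.

Fixpoint keys (K : Type) (t : tree K) : seq K :=
  if t is Node l k r then keys l ++ k :: keys r else [::].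

Fixpoint bst (n : nat) (t : tree 'I_n) : bool :=
  if t is Node l k r then
    [&& all (fun y : 'I_n => y < k)%N (keys l),
        all (fun y : 'I_n => k < y)%N (keys r), bst l & bst r]
  else true.

(** [ancestor t y x]: [x] occurs in a subtree of [t] rooted at [y]; every node
    is an ancestor (and a descendant) of itself. *)
Fixpoint ancestor (n : nat) (t : tree 'I_n) (y x : 'I_n) : bool :=
  if t is Node l k r then
    [|| (y == k) && (x \in keys t), ancestor l y x | ancestor r y x]
  else false.

Definition depth (n : nat) (t : tree 'I_n) (x : 'I_n) : nat :=
  #|[set y | ancestor t y x]%SET|.

Definition is_treap_on (R : realType) (n : nat) (pri : 'I_n -> R)
    (s : seq 'I_n) (t : tree 'I_n) : Prop :=
  [/\ bst t, keys t =i s &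
      forall x y : 'I_n, ancestor t y x -> pri x <= pri y].

(** The recursive construction. [m] is fuel and only needs to be at least
    [size s]. For tied priorities the arg max is still some maximizer,
    determined by the comparisons between priorities. *)
Fixpoint treap_rec (R : realType) (n : nat) (pri : 'I_n -> R) (m : nat)
    (s : seq 'I_n) : tree 'I_n :=
  match m, s with
  | m'.+1, x0 :: _ =>
      let k := [arg max_(y > x0 | y \in s) pri y]%O in
      Node (treap_rec pri m' [seq y : 'I_n <- s | (y < k)%N]) k
           (treap_rec pri m' [seq y : 'I_n <- s | (k < y)%N])
  | _, _ => Leaf
  end.

Definition treap (R : realType) (n : nat) (pri : 'I_n -> R) : tree 'I_n :=
  treap_rec pri n (enum 'I_n).

Lemma treap_recP (R : realType) (n : nat) (pri : 'I_n -> R) (m : nat)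
    (s : seq 'I_n) : (size s <= m)%N -> is_treap_on pri s (treap_rec pri m s).
Proof.
elim: m s => [|m IH] [|x0 s'] //= Hs.
set s := x0 :: s'; set k := Order.arg_max _ _ _.
have [ks kmax] : k \in s /\ forall y, y \in s -> pri y <= pri k.
  by rewrite /k; case: arg_maxP => [|i ? ?]; [exact: mem_head|].
have size_lt (p : pred 'I_n) : ~~ p k -> (size [seq y <- s | p y] <= m)%N.
  move=> pk; rewrite size_filter -ltnS; apply: leq_trans (Hs : (size s <= m.+1)%N).
  rewrite -(count_predC p s) -addn1 leq_add2l -has_count.
  by apply/hasP; exists k.
have [bl kl hl] := IH [seq y : 'I_n <- s | (y < k)%N]
  (size_lt (fun y : 'I_n => (y < k)%N) (negbT (ltnn k))).
have [br kr hr] := IH [seq y : 'I_n <- s | (k < y)%N]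
  (size_lt (fun y : 'I_n => (k < y)%N) (negbT (ltnn k))).
have kE : keys (Node (treap_rec pri m [seq y : 'I_n <- s | (y < k)%N]) k
    (treap_rec pri m [seq y : 'I_n <- s | (k < y)%N])) =i s.
  move=> y /=; rewrite mem_cat in_cons kl kr !mem_filter.
  have [->|yk] := eqVneq y k; first by rewrite ks orbT.
  by case: ltngtP (yk) => //= [|/val_inj ->]; rewrite ?orbF // eqxx.
split.
- rewrite /= bl br !andbT; apply/andP; split; apply/allP => y.
    by rewrite kl mem_filter => /andP[].
  by rewrite kr mem_filter => /andP[].
- exact: kE.
- move=> x y /or3P[/andP[/eqP -> xk]|/hl|/hr] //.
  by apply: kmax; rewrite -kE.
Qed.

Lemma is_treap_on_uniq (R : realType) (n : nat) (pri : 'I_n -> R)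
    (s : seq 'I_n) (t u : tree 'I_n) : injective pri ->
  is_treap_on pri s t -> is_treap_on pri s u -> t = u.
Proof.
move=> pri_inj; elim: t s u => [|l IHl k r IHr] s [|l' k' r'] //.
- by move=> [_ ks _] [_ ks' _]; have := ks' k'; rewrite -ks /= mem_cat mem_head orbT.
- by move=> [_ ks _] [_ ks' _]; have := ks k; rewrite -ks' /= mem_cat mem_head orbT.
move=> [/= /and4P[/allP al /allP ar bl br] ks ht].
move=> [/= /and4P[/allP al' /allP ar' bl' br'] ks' ht'].
have kk' : k = k'.
  apply: pri_inj; apply/eqP; rewrite eq_le; apply/andP; split.
    by apply: ht'; rewrite eqxx ks' -ks mem_cat mem_head orbT.
  by apply: ht; rewrite eqxx ks -ks' mem_cat mem_head orbT.
subst k'.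
have sub (y : 'I_n) : (y \in keys l = (y \in s) && (y < k)%N)
                    * (y \in keys r = (y \in s) && (k < y)%N).
  rewrite -ks mem_cat inE.
  have := al y; have := ar y; rewrite -(inj_eq val_inj) /=.
  case: (y \in keys l); case: (y \in keys r); case: ltngtP => //=;
    by [move=> _ _ /(_ isT) | move=> _ /(_ isT)].
have sub' (y : 'I_n) : (y \in keys l' = (y \in s) && (y < k)%N)
                    * (y \in keys r' = (y \in s) && (k < y)%N).
  rewrite -ks' mem_cat inE.
  have := al' y; have := ar' y; rewrite -(inj_eq val_inj) /=.
  case: (y \in keys l'); case: (y \in keys r'); case: ltngtP => //=;
    by [move=> _ _ /(_ isT) | move=> _ /(_ isT)].
congr Node.
- apply: (IHl (keys l)); split=> //.
  + by move=> x y A; apply: ht; rewrite A !orbT.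
  + by move=> y; rewrite sub sub'.
  + by move=> x y A; apply: ht'; rewrite A !orbT.
- apply: (IHr (keys r)); split=> //.
  + by move=> x y A; apply: ht; rewrite A !orbT.
  + by move=> y; rewrite sub sub'.
  + by move=> x y A; apply: ht'; rewrite A !orbT.
Qed.

(** [treap pri] is a binary search tree on all of ['I_n] with the heap
    property, and the only one when the priorities are distinct. *)
Lemma treapP (R : realType) (n : nat) (pri : 'I_n -> R) :
  is_treap_on pri (enum 'I_n) (treap pri).
Proof. by apply: treap_recP; rewrite size_enum_ord. Qed.

Lemma treap_uniq (R : realType) (n : nat) (pri : 'I_n -> R) (t : tree 'I_n) :
  injective pri -> is_treap_on pri (enum 'I_n) t -> t = treap pri.
Proof. by move=> pri_inj tP; apply: is_treap_on_uniq tP (treapP _). Qed.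

Definition log2 (R : realType) (x : R) : R := ln x / ln 2.

Definition priority (R : realType) (n : nat) (w del : 'I_n -> R)
    (x : 'I_n) : R :=
  - (Num.floor (log2 (log2 (w x)^-1)))%:~R + del x.

(** Subfamilies of size at most [k] rather than exactly [k], so that the notion
    is also meaningful when there are fewer than [k] variables. *)
Definition kwise_independent (d : measure_display) (T : measurableType d)
    (R : realType) (P : probability T R) (I : finType) (k : nat)
    (X : I -> {RV P >-> R}) : Prop :=
  forall S : {set I}, (#|S| <= k)%N ->
  forall A : I -> set R, (forall i, measurable (A i)) ->
    (P (\bigcap_(i in [set` S]) (X i @^-1` A i)) =
     \prod_(i in S) P (X i @^-1` A i))%E.

Definition uniform01 (d : measure_display) (T : measurableType d)
    (R : realType) (P : probability T R) (X : {RV P >-> R}) : Prop :=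
  forall A : set R, measurable A ->
    distribution P X A = uniform_prob (@ltr01 R) A.

(* Main.v *)
Require Import Defs.
From mathcomp Require Import all_boot all_order all_algebra.
From mathcomp Require Import all_classical all_reals all_analysis.
From mathcomp Require Import measurable_realfun.
From mathcomp Require Import ring lra zify.

Import Order.TTheory GRing.Theory Num.Theory.

Local Open Scope ring_scope.

(** The tier of an item is [floor (log2 (log2 (1/w)))]. An ancestor [y] of [x]
    has a priority at least that of every item between [x] and [y]; hence,
    almost surely, [y] has tier at most that of [x] and an offset dominating
    those of the [s] items of its own tier that lie between [x] and [y]. By
    5-wise independence this has probability [O(1/(s+1))]: if the offset of [y]
    lies at distance about [p] below 1, then none of the [s] other offsets
    exceeds [1 - p], an event of probability [O((s p)^-2)] by a fourth-moment
    bound, and the sum over dyadic [p >= 1/s] converges. Summing over a tier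
    gives a harmonic sum, so tier [t], which has [O(2^(2^(t+1)))] items because
    their weights exceed [2^-(2^(t+1))], contributes [O(2^t)] ancestors on
    average. The geometric sum over the tiers up to that of [x] is
    [O(log2 (1/w x))]. *)

(** * Ancestors in a treap *)

Lemma ancestor_keys (n : nat) (t : tree 'I_n) (y x : 'I_n) :
  ancestor t y x -> (y \in keys t) && (x \in keys t).
Proof.
elim: t => [//|l IHl k r IHr] /=; rewrite !mem_cat !inE.
case/or3P => [/andP[/eqP -> ->]|/IHl/andP[-> ->]|/IHr/andP[-> ->]] //;
  by rewrite ?eqxx ?orbT.
Qed.

(** Unless the root is [y], the search order puts [x] and [y] on the same side of it, and [z], being
    between them, falls on that side too. *)
Lemma ancestor_between (n : nat) (t : tree 'I_n) (y x z : 'I_n) :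
  bst t -> z \in keys t -> (minn x y <= z <= maxn x y)%N ->
  ancestor t y x -> ancestor t y z.
Proof.
move=> + + zxy; elim: t => [//|l IHl k r IHr] /=.
case/and4P => /allP al /allP ar bl br zk.
case/or3P => [/andP[-> _]|/[dup]/ancestor_keys/andP[yl xl] h|
              /[dup]/ancestor_keys/andP[yl xl] h].
- by rewrite zk.
- have zlt : (z < k)%N by have := al _ yl; have := al _ xl; lia.
  suff zl : z \in keys l by rewrite (IHl bl zl h) orbT.
  move: zk; rewrite mem_cat inE => /or3P[//|/eqP zE|/ar]; last by lia.
  by rewrite zE ltnn in zlt.
- have zlt : (k < z)%N by have := ar _ yl; have := ar _ xl; lia.
  suff zl : z \in keys r by rewrite (IHr br zl h) !orbT.
  move: zk; rewrite mem_cat inE => /or3P[/al|/eqP zE|//]; first by lia.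
  by rewrite zE ltnn in zlt.
Qed.

Lemma treap_ancestor_max (R : realType) (n : nat) (pri : 'I_n -> R)
    (y x z : 'I_n) :
  ancestor (treap pri) y x -> (minn x y <= z <= maxn x y)%N -> pri z <= pri y.
Proof.
have [bt kt ht] := treapP pri => yx zxy; apply: ht.
by apply: ancestor_between zxy yx; rewrite ?kt ?mem_enum.
Qed.

(** * Expectation of bounded measurable functions *)

Section BoundedExpectation.
Context {R : realType} {d : measure_display} {T : measurableType d}.
Variable P : probability T R.
Local Open Scope classical_set_scope.

(** A class closed under sums and products on which [Ex] is linear, so that later arguments carry no
    integrability conditions. *)
Definition bounded_meas (f : T -> R) :=
  measurable_fun setT f /\ exists M, forall t, `|f t| <= M.

Definition Ex (f : T -> R) : R := Rintegral P setT f.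

Lemma bounded_meas_integrable f : bounded_meas f ->
  P.-integrable setT (EFin \o f).
Proof.
move=> [mf [M fM]]; apply: measurable_bounded_integrable => //.
  exact: le_lt_trans (probability_le1 P measurableT) (ltry _).
exists M; split; first exact: num_real.
by move=> N MN t _; apply: le_trans (fM t) (ltW MN).
Qed.

Lemma bounded_meas_cst c : bounded_meas (fun=> c).
Proof. by split; [exact: measurable_cst | exists `|c|]. Qed.

Lemma bounded_measD f g : bounded_meas f -> bounded_meas g ->
  bounded_meas (fun t => f t + g t).
Proof.
move=> [mf [M fM]] [mg [N gN]]; split; first exact: measurable_funD.
by exists (M + N) => t; apply: le_trans (ler_normD _ _) (lerD _ _).
Qed.

Lemma bounded_measM f g : bounded_meas f -> bounded_meas g ->
  bounded_meas (fun t => f t * g t).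
Proof.
move=> [mf [M fM]] [mg [N gN]]; split; first exact: measurable_funM.
by exists (M * N) => t; rewrite normrM ler_pM.
Qed.

Lemma bounded_meas_sum (I : Type) (s : seq I) (Q : pred I) (f : I -> T -> R) :
  (forall i, bounded_meas (f i)) ->
  bounded_meas (fun t => \sum_(i <- s | Q i) f i t).
Proof.
move=> bf; elim: s => [|i s IH].
  by under eq_fun do rewrite big_nil; exact: bounded_meas_cst.
under eq_fun do rewrite big_cons.
by case: (Q i) => //; exact: bounded_measD.
Qed.

Lemma bounded_meas_prod (I : Type) (s : seq I) (Q : pred I) (f : I -> T -> R) :
  (forall i, bounded_meas (f i)) ->
  bounded_meas (fun t => \prod_(i <- s | Q i) f i t).
Proof.
move=> bf; elim: s => [|i s IH].
  by under eq_fun do rewrite big_nil; exact: bounded_meas_cst.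
under eq_fun do rewrite big_cons.
by case: (Q i) => //; exact: bounded_measM.
Qed.

Lemma bounded_meas_indic A : measurable A -> bounded_meas \1_A.
Proof.
move=> mA; split; first exact: measurable_indic.
by exists 1 => t; rewrite indicE normr_nat; case: (_ \in _); rewrite ?ler01.
Qed.

Lemma ExD f g : bounded_meas f -> bounded_meas g ->
  Ex (fun t => f t + g t) = Ex f + Ex g.
Proof.
by move=> bf bg; rewrite /Ex RintegralD//; apply: bounded_meas_integrable.
Qed.

Lemma ExZ c f : bounded_meas f -> Ex (fun t => c * f t) = c * Ex f.
Proof. by move=> bf; rewrite /Ex RintegralZl//; exact: bounded_meas_integrable. Qed.

Lemma Ex_cst c : Ex (fun=> c) = c.
Proof.
transitivity (c * fine (P setT)); first exact: Rintegral_cst.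
by have -> : P setT = 1%E; [exact: probability_setT | rewrite mulr1].
Qed.

Lemma Ex_sum (I : Type) (s : seq I) (Q : pred I) (f : I -> T -> R) :
  (forall i, bounded_meas (f i)) ->
  Ex (fun t => \sum_(i <- s | Q i) f i t) = \sum_(i <- s | Q i) Ex (f i).
Proof.
move=> bf; elim: s => [|i s IH].
  by under eq_fun do rewrite big_nil; rewrite big_nil Ex_cst.
under eq_fun do rewrite big_cons; rewrite big_cons.
by case: (Q i) => //; rewrite ExD ?IH//; exact: bounded_meas_sum.
Qed.

Lemma le_Ex f g : bounded_meas f -> bounded_meas g -> (forall t, f t <= g t) ->
  Ex f <= Ex g.
Proof.
move=> bf bg fg; apply: le_Rintegral => //; exact: bounded_meas_integrable.
Qed.

Lemma Ex_indic A : measurable A -> Ex \1_A = fine (P A).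
Proof. by move=> mA; rewrite /Ex /Rintegral integral_indic// setIT. Qed.

(* [f] need not be measurable: the integral of a nonnegative function is a
   supremum over the simple functions below it. *)
Lemma expectation_le_Ex f g : (forall t, 0 <= f t <= g t) -> bounded_meas g ->
  ('E_P[f] <= (Ex g)%:E)%E.
Proof.
move=> fg bg.
have f0 t : 0 <= f t by case/andP: (fg t).
have g0 t : 0 <= g t by case/andP: (fg t) => /le_trans; apply.
rewrite /Ex /Rintegral fineK; last first.
  by apply: integrable_fin_num => //; exact: bounded_meas_integrable.
rewrite unlock !ge0_integralTE; [|by move=> t; rewrite lee_fin..].
apply: le_ereal_sup => _ [h hf <-]; exists h => // t.
by apply: le_trans (hf t) _; rewrite lee_fin; case/andP: (fg t).
Qed.
End BoundedExpectation.

(** * Records among uniform variables with limited independence *)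

Lemma uniform_prob01E (R : realType) (U : set R) : measurable U ->
  uniform_prob (@ltr01 R) U = lebesgue_measure (U `&` `[0, 1])%classic.
Proof.
move=> mU; rewrite /uniform_prob integral_uniform_pdf.
rewrite (eq_integral (cst 1%E)) => [|x]; last first.
  by rewrite inE => -[_ /=]; rewrite in_itv/= /uniform_pdf => ->; rewrite subr0 invr1.
rewrite integral_cst ?mul1e//.
by apply: measurableI => //; exact: measurable_itv.
Qed.

Lemma exists_subset_card (I : finType) (S : {set I}) (m : nat) : (m <= #|S|)%N ->
  exists2 Q : {set I}, Q \subset S & #|Q| = m.
Proof.
move=> /card_geqP[s [us sm sS]]; exists [set x in s]%SET.
  by apply/fintype.subsetP => x; rewrite inE => /sS.
by rewrite cardsE (card_uniqP us).
Qed.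

(** * Products of indicators under limited independence *)

Section Independence.
Context {R : realType} {d : measure_display} {T : measurableType d}.
Variable P : probability T R.
Context {I : finType} {k : nat}.
Variable X : I -> {RV P >-> R}.
Hypothesis ind : kwise_independent k X.
Local Open Scope classical_set_scope.

Definition hit (i : I) (A : set R) (t : T) : R := \1_(X i @^-1` A) t.

Definition prob_hit (i : I) (A : set R) : R := fine (P (X i @^-1` A)).

Lemma measurable_hit i A : measurable A -> measurable (X i @^-1` A).
Proof.
by move=> mA; apply: measurable_funPTI.
Qed.

Lemma bounded_meas_hit i A : measurable A -> bounded_meas (hit i A).
Proof. by move=> mA; apply: bounded_meas_indic; exact: measurable_hit. Qed.

Lemma Ex_hit i A : measurable A -> Ex P (hit i A) = prob_hit i A.
Proof. by move=> mA; rewrite Ex_indic//; exact: measurable_hit. Qed.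

Lemma Ex_prod_hit (S : {set I}) (A : I -> set R) : (#|S| <= k)%N ->
  (forall i, measurable (A i)) ->
  Ex P (fun t => \prod_(i in S) hit i (A i) t) = \prod_(i in S) prob_hit i (A i).
Proof.
move=> Sk mA.
have -> : (fun t => \prod_(i in S) hit i (A i) t) =
    \1_(\bigcap_(i in [set` S]) (X i @^-1` A i)).
  apply/funext => t; rewrite indicE /hit.
  have [tS|/negP tS] := boolP (t \in _).
    rewrite big1 // => i iS; rewrite indicE mem_set //.
    by move: tS; rewrite inE; apply.
  have [i iS ni] : exists2 i, i \in S & ~ (X i @^-1` A i) t.
    apply: contrapT => h; apply: tS; rewrite inE => i /= iS.
    by apply: contrapT => hi; apply: h; exists i.
  by rewrite (bigD1 i)//= indicE memNset// mul0r.
rewrite Ex_indic; last first.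
  by apply: fin_bigcap_measurable => // i _; exact: measurable_hit.
rewrite ind// /prob_hit.
(* Independence is an identity of extended reals; real representatives of the probabilities let the
   product be taken in [R]. *)
have /all_sig[p pE] : forall i, {p : R | P (X i @^-1` A i) = p%:E}.
  move=> i; exists (fine (P (X i @^-1` A i))); rewrite fineK//.
  exact/fin_num_measure/measurable_hit.
under eq_bigr do rewrite pE.
rewrite -[RHS]/(fine (\prod_(i in S) p i)%:E); congr fine.
by elim/big_ind2 : _ => // ? x ? y -> ->; rewrite EFinM.
Qed.

(** The product expands over the subsets of [S], and each term is a product of at most [k]
    indicators. *)
Lemma Ex_prod_affine (S : {set I}) (A : I -> set R) (a b : I -> R) :
  (#|S| <= k)%N -> (forall i, measurable (A i)) ->
  Ex P (fun t => \prod_(i in S) (a i * hit i (A i) t + b i)) =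
  \prod_(i in S) (a i * prob_hit i (A i) + b i).
Proof.
move=> Sk mA.
(* The values 0 and 1 outside [S] extend the product to all of [I], where distributivity applies; a
   subset not contained in [S] then contributes 0. *)
pose a' i := if i \in S then a i else 0.
pose b' i := if i \in S then b i else 1.
have prodE (h : I -> R) : \prod_(i in S) (a i * h i + b i) =
    \sum_(J in {set I}) (\prod_i if i \in J then a' i else b' i) *
      \prod_(i in J) h i.
  rewrite big_mkcond/= (eq_bigr (fun i => a' i * h i + b' i)); last first.
    by move=> i _; rewrite /a' /b'; case: ifP => //; rewrite mul0r add0r.
  rewrite bigA_distr; apply: eq_bigr => J _.
  rewrite [X in _ * X]big_mkcond -big_split/=; apply: eq_bigr => i _.
  by case: ifP => //; rewrite mulr1.
rewrite prodE (eq_fun (fun t => prodE (fun i => hit i (A i) t))).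
have bprod J : bounded_meas (fun t => \prod_(i in J) hit i (A i) t).
  by apply: bounded_meas_prod => i; exact: bounded_meas_hit.
rewrite Ex_sum; last first.
  by move=> J; apply: bounded_measM => //; exact: bounded_meas_cst.
apply: eq_bigr => J _; rewrite ExZ//.
have [JS|/subsetPn[i iJ iS]] := boolP (J \subset S).
  by rewrite Ex_prod_hit// (leq_trans _ Sk)// subset_leq_card.
by rewrite (bigD1 i)//= iJ /a' (negbTE iS) !mul0r.
Qed.

Lemma hit01 i D t : (hit i D t == 0) || (hit i D t == 1).
Proof. by rewrite /hit indicE; case: (_ \in _); rewrite !eqxx ?orbT. Qed.

Lemma prob_hit_ge0 i D : 0 <= prob_hit i D.
Proof. exact: fine_ge0. Qed.

Lemma prob_hit_le1 i D : measurable D -> prob_hit i D <= 1.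
Proof.
move=> mD; rewrite /prob_hit -lee_fin fineK.
  exact/probability_le1/measurable_hit.
exact/fin_num_measure/measurable_hit.
Qed.

Hypothesis k5 : (5 <= k)%N.

(** * A fourth-moment bound on the probability of no hit *)

Section FourthMoment.
Variables (y : I) (S1 S2 : {set I}) (A B : set R) (p : R).
Hypothesis mA : measurable A.
Hypothesis mB : measurable B.
Hypothesis S12 : [disjoint S1 & S2]%B.
Hypothesis yS1 : y \notin S1.
Hypothesis yS2 : y \notin S2.
Hypothesis hitA : forall i, prob_hit i A = p.

(** For [h] in {0, 1}, the square of [h - p] is [(1 - 2 * p) * h + p ^+ 2]; for distinct indices
    each factor remains [h - p]. The boolean tells the two cases apart. *)
Let sqa (e : bool) : R := if e then 1 - 2 * p else 1.
Let sqb (e : bool) : R := if e then p ^+ 2 else - p.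

(* A product of two centred indicators is affine in each indicator involved,
   even when the two coincide, because indicators are idempotent. *)
Let centred_mul (a b : I) (h : I -> R) : (forall i, (h i == 0) || (h i == 1)) ->
  (h a - p) * (h b - p) =
  \prod_(i in [set a; b]%SET) (sqa (a == b) * h i + sqb (a == b)).
Proof.
move=> h01; have [<-|ab] := eqVneq a b.
  rewrite finset.setUid big_set1 /sqa /sqb.
  by case/orP: (h01 a) => /eqP ->; ring.
by rewrite big_setU1 ?inE// big_set1 /sqa /sqb !mul1r.
Qed.

(** These are the covariances: the variance of an indicator on the diagonal, 0 off it. *)
Let centred_mul_mean (a b : I) :
  \prod_(i in [set a; b]%SET) (sqa (a == b) * p + sqb (a == b)) =
  (if a == b then p * (1 - p) else 0).
Proof.
have [<-|ab] := eqVneq a b.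
  by rewrite finset.setUid big_set1 /sqa /sqb; ring.
by rewrite big_setU1 ?inE// big_set1 /sqa /sqb /=; ring.
Qed.

Let dev i t := hit i A t - p.

Let bounded_dev i : bounded_meas (dev i).
Proof.
by apply: bounded_measD; [exact: bounded_meas_hit | exact: bounded_meas_cst].
Qed.

(** At most five variables occur, namely [y] and the two pairs, which is where [k5] enters. The
    pairs do not meet, so the mean factors. *)
Let Ex_quad a b c e : a \in S1 -> b \in S1 -> c \in S2 -> e \in S2 ->
  Ex P (fun t => hit y B t * ((dev a t * dev b t) * (dev c t * dev e t))) =
  prob_hit y B * ((if a == b then p * (1 - p) else 0) *
                  (if c == e then p * (1 - p) else 0)).
Proof.
move=> aS bS cS eS.
set S := (y |: ([set a; b] :|: [set c; e]))%SET.
have ab_S1 i : i \in [set a; b]%SET -> i \in S1 by rewrite !inE => /orP[]/eqP->.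
have ce_S2 i : i \in [set c; e]%SET -> i \in S2 by rewrite !inE => /orP[]/eqP->.
have abce : [disjoint [set a; b]%SET & [set c; e]%SET]%B.
  by apply: disjointW S12; apply/fintype.subsetP.
have yS : y \notin ([set a; b] :|: [set c; e])%SET.
  rewrite inE; apply/norP; split; [apply: contra yS1|apply: contra yS2] => h;
  by [exact: ab_S1|exact: ce_S2].
(* These coefficients merge the indicator of [y] and the affine forms of both pairs into one affine
   product over [S]. *)
pose al i := if i == y then 1 else if i \in S1 then sqa (a == b) else sqa (c == e).
pose be i := if i == y then 0 else if i \in S1 then sqb (a == b) else sqb (c == e).
have prodE (h : I -> R) : \prod_(i in S) (al i * h i + be i) =
    h y * ((\prod_(i in [set a; b]%SET) (sqa (a == b) * h i + sqb (a == b))) *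
           (\prod_(i in [set c; e]%SET) (sqa (c == e) * h i + sqb (c == e)))).
  rewrite big_setU1//= /al /be eqxx mul1r addr0; congr (_ * _).
  rewrite (eq_bigl [predU [set a; b]%SET & [set c; e]%SET]); last first.
    by move=> i; rewrite !inE.
  rewrite bigU//=.
  congr (_ * _); apply: eq_bigr => i iS.
    have i1 := ab_S1 _ iS; rewrite i1.
    by case: eqP => // iy; have := yS1; rewrite -iy i1.
  have i2 := ce_S2 _ iS; case: eqP => [iy|_]; first by have := yS2; rewrite -iy i2.
  by rewrite (disjointFl S12 i2).
pose D i := if i == y then B else A.
have hD i t : i != y -> hit i (D i) t = hit i A t by rewrite /D => /negbTE ->.
have mD i : measurable (D i) by rewrite /D; case: ifP.
have Sk : (#|S| <= k)%N.
  apply: leq_trans k5; rewrite cardsU1 cardsU !cards2.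
  by case: (_ \notin _); case: (a != b); case: (c != e); lia.
have n1 i : i \in S1 -> i != y by apply: contraTneq => ->.
have n2 i : i \in S2 -> i != y by apply: contraTneq => ->.
have Dy : D y = B by rewrite /D eqxx.
transitivity (Ex P (fun t => \prod_(i in S) (al i * hit i (D i) t + be i))).
  congr Ex; apply/funext => t; rewrite prodE.
  have h01 i : (hit i (D i) t == 0) || (hit i (D i) t == 1) by exact: hit01.
  rewrite -(centred_mul a b _ h01) -(centred_mul c e _ h01) Dy.
  rewrite /dev (hD _ _ (n1 _ aS)) (hD _ _ (n1 _ bS)).
  by rewrite (hD _ _ (n2 _ cS)) (hD _ _ (n2 _ eS)).
have mean_ab (u v : I) (Q : {pred I}) : {in Q, forall i, i != y} ->
    {subset [set u; v]%SET <= Q} ->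
  \prod_(i in [set u; v]%SET) (sqa (u == v) * prob_hit i (D i) + sqb (u == v)) =
  (if u == v then p * (1 - p) else 0).
  move=> Qy uvQ; rewrite -centred_mul_mean; apply: eq_bigr => i /uvQ/Qy iy.
  by rewrite /D (negbTE iy) hitA.
rewrite Ex_prod_affine// prodE Dy; congr (_ * (_ * _)).
  exact: (mean_ab _ _ (mem S1)).
exact: (mean_ab _ _ (mem S2)).
Qed.

(* On the event that [X y] hits [B] and nothing in [S1] and [S2] hits [A], the
   two sums of [dev] are [- m p]; their squares have independent means. Splitting
   the family in two replaces a fourth moment by a product of variances. *)
Lemma prob_hit_miss_le (m : nat) (S : {set I}) :
  #|S1| = m -> #|S2| = m -> S1 \subset S -> S2 \subset S ->
  (m%:R * p) ^+ 2 * Ex P (fun t => hit y B t * \prod_(i in S) (1 - hit i A t))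
    <= prob_hit y B.
Proof.
move=> S1m S2m S1S S2S.
have p0 : 0 <= p by rewrite -(hitA y) prob_hit_ge0.
have p1 : p <= 1 by rewrite -(hitA y) prob_hit_le1.
have bB : bounded_meas (hit y B) by exact: bounded_meas_hit.
have bmiss : bounded_meas (fun t => hit y B t * \prod_(i in S) (1 - hit i A t)).
  apply: bounded_measM => //; apply: bounded_meas_prod => i.
  apply: bounded_measD; first exact: bounded_meas_cst.
  rewrite (_ : (fun t => - hit i A t) = (fun t => -1 * hit i A t)).
    by apply: bounded_measM; [exact: bounded_meas_cst|exact: bounded_meas_hit].
  by apply/funext => t; rewrite mulN1r.
(* The final step cancels a power of [m%:R * p], so the zero case is settled first. *)
have [->|mp0] := eqVneq (m%:R * p) 0.
  by rewrite expr0n mul0r prob_hit_ge0.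
have {}mp0 : 0 < m%:R * p by rewrite lt_neqAle eq_sym mp0 mulr_ge0.
pose quad a b c e t := hit y B t * ((dev a t * dev b t) * (dev c t * dev e t)).
have bquad a b c e : bounded_meas (quad a b c e).
  apply: bounded_measM => //; apply: bounded_measM; exact: bounded_measM.
pose W t :=
  \sum_(a in S1) \sum_(b in S1) \sum_(c in S2) \sum_(e in S2) quad a b c e t.
have bW : bounded_meas W by do 4![apply: bounded_meas_sum => ?].
have WE t : W t = hit y B t *
    ((\sum_(a in S1) dev a t) ^+ 2 * (\sum_(c in S2) dev c t) ^+ 2).
  have sq (Q : {set I}) : (\sum_(a in Q) dev a t) ^+ 2 =
      \sum_(a in Q) \sum_(b in Q) dev a t * dev b t by rewrite expr2 big_distrlr.
  rewrite /W !sq.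
  rewrite big_distrl big_distrr/=; apply: eq_bigr => a _.
  rewrite big_distrl big_distrr/=; apply: eq_bigr => b _.
  rewrite big_distrr big_distrr/=; apply: eq_bigr => c _.
  by rewrite big_distrr big_distrr.
have sum_dev (Q : {set I}) t : #|Q| = m -> (forall i, i \in Q -> hit i A t = 0) ->
    \sum_(i in Q) dev i t = - (m%:R * p).
  move=> <- Q0; rewrite (eq_bigr (fun=> - p)) => [|i iQ]; last by rewrite /dev Q0 ?sub0r.
  by rewrite sumr_const mulNrn mulr_natl.
(* If nothing in [S] hits [A], both sums equal [- (m%:R * p)] and equality holds; otherwise the left
   side vanishes and [W] is nonnegative. *)
have leW t : (m%:R * p) ^+ 4 * (hit y B t * \prod_(i in S) (1 - hit i A t)) <= W t.
  have hB0 : 0 <= hit y B t by case/orP: (hit01 y B t) => /eqP ->.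
  rewrite WE; have [h0|/forall_inPn[i iS]] := boolP [forall i in S, hit i A t == 0].
    rewrite !sum_dev// => [|i iQ|i iQ].
    - rewrite big1 ?mulr1 => [|i iS]; last first.
        by rewrite (eqP (forall_inP h0 i iS)) subr0.
      by rewrite sqrrN -exprD mulrC.
    - by rewrite (eqP (forall_inP h0 i _))//; apply: (fintype.subsetP S2S).
    - by rewrite (eqP (forall_inP h0 i _))//; apply: (fintype.subsetP S1S).
  case/orP: (hit01 i A t) => [->//|/eqP h1 _].
  rewrite (bigD1 i)//= h1 subrr mul0r !mulr0.
  by rewrite mulr_ge0// mulr_ge0// sqr_ge0.
have var_sum (Q : {set I}) : #|Q| = m ->
    \sum_(a in Q) \sum_(b in Q) (if a == b then p * (1 - p) else 0) =
    m%:R * (p * (1 - p)).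
  move=> <-; rewrite (eq_bigr (fun=> p * (1 - p))) => [|a aQ].
    by rewrite sumr_const mulr_natl.
  rewrite (bigD1 a)//= eqxx big1 ?addr0// => b /andP[_].
  by rewrite eq_sym => /negbTE ->.
have ExW : Ex P W = prob_hit y B * (m%:R * (p * (1 - p))) ^+ 2.
  rewrite /W Ex_sum; last by move=> a; do 3![apply: bounded_meas_sum => ?].
  rewrite expr2 -{1}(var_sum S1)// -(var_sum S2)// big_distrl big_distrr/=.
  apply: eq_bigr => a aS.
  rewrite Ex_sum; last by move=> b; do 2![apply: bounded_meas_sum => ?].
  rewrite big_distrl big_distrr/=; apply: eq_bigr => b bS.
  rewrite Ex_sum; last by move=> c; do 1![apply: bounded_meas_sum => ?].
  rewrite big_distrr big_distrr/=; apply: eq_bigr => c cS.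
  rewrite Ex_sum//.
  rewrite big_distrr big_distrr/=; apply: eq_bigr => e eS.
  exact: Ex_quad.
(* A further factor [(m%:R * p) ^+ 2] produces the fourth power of [leW]; it cancels against the
   product of the two variances. *)
rewrite -(ler_pM2l (exprn_gt0 2 mp0)) mulrA -exprD -ExZ//.
apply: (le_trans (@le_Ex _ _ _ P _ _ _ bW leW)).
  by apply: bounded_measM => //; exact: bounded_meas_cst.
rewrite ExW mulrC ler_wpM2r ?prob_hit_ge0// !exprMn ler_wpM2l ?sqr_ge0//.
by rewrite ler_piMr ?sqr_ge0// exprn_ile1 ?subr_ge0//; lra.
Qed.
End FourthMoment.

(** * Dyadic layers of a uniform variable *)

Hypothesis unif : forall i, uniform01 (X i).

Lemma prob_hit_tail i (c : R) : 0 <= c <= 1 -> prob_hit i `]c, +oo[ = 1 - c.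
Proof.
move=> c01; rewrite /prob_hit.
rewrite -[P _]/(distribution P (X i) `]c, +oo[) unif// uniform_prob01E//.
have -> : `]c, +oo[ `&` `[0, 1] = `]c, 1] :> set R.
  by apply/seteqP; split => x /=; rewrite !in_itv/=; lra.
rewrite lebesgue_measure_itv/= lte_fin.
by have [c1|c1] := ltrP c 1 => /=; lra.
Qed.

Let tail (j : nat) : set R := `](1 - 2^-1 ^+ j), +oo[.

Let hit_tail i j t : hit i (tail j) t = (1 - 2^-1 ^+ j < X i t)%R%:R.
Proof.
rewrite /hit indicE /tail; congr (nat_of_bool _)%:R.
by apply/idP/idP; rewrite inE/= in_itv/= andbT.
Qed.

Let prob_tail i j : prob_hit i (tail j) = 2^-1 ^+ j.
Proof.
have h0 : 0 <= 2^-1 :> R by rewrite invr_ge0.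
have h1 : 2^-1 <= 1 :> R by rewrite invf_le1 ?ler1n.
have e0 : 0 <= 2^-1 ^+ j :> R by exact: exprn_ge0.
have e1 : 2^-1 ^+ j <= 1 :> R by exact: exprn_ile1.
rewrite (prob_hit_tail i (1 - 2^-1 ^+ j)); lra.
Qed.

(* The sum is nonzero at the last [j] for which [X y] exceeds [1 - 2^-j]: then
   [X y], hence all of [S], is at most [1 - 2^-(j+1)]. *)
Let layer_cover (S : {set I}) (y : I) (t : T) (L : nat) :
  (forall z, z \in S -> X z t <= X y t) ->
  1 <= (1 - hit y (tail 0) t) + hit y (tail L) t +
    \sum_(j < L) hit y (tail j) t * \prod_(z in S) (1 - hit z (tail j.+1) t).
Proof.
move=> ymax; elim: L => [|L IH]; first by rewrite big_ord0; lra.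
rewrite big_ord_recr/=; apply: le_trans IH _.
set A0 := 1 - _; set s := \sum_(_ < _) _; set q := \prod_(_ in _) _.
(* Adding a layer shrinks the tail. If [X y] is still in the smaller tail, that term pays; otherwise
   every element of [S] misses it and [q] is 1. *)
suff : hit y (tail L) t <= hit y (tail L.+1) t + hit y (tail L) t * q by lra.
have [yL|yL] := ltrP (1 - 2^-1 ^+ L.+1) (X y t).
  rewrite [in X in _ <= X + _]hit_tail yL.
  have q0 : 0 <= q.
    by apply: prodr_ge0 => z _; case/orP: (hit01 z (tail L.+1) t) => /eqP ->; lra.
  by case/orP: (hit01 y (tail L) t) => /eqP -> /=; lra.
rewrite {1}/q /q big1 ?mulr1 ?lerDr ?hit_tail ?ler0n// => z zS.
by rewrite hit_tail ltNge (le_trans (ymax z zS) yL) subr0.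
Qed.

(* Stated with a majorant so that the depth, which is below a sum of such
   majorants, need not be shown measurable. *)
Lemma record_majorant (S : {set I}) (y : I) : y \notin S ->
  exists g : T -> R, [/\ bounded_meas g, (forall t, 0 <= g t),
    (forall t, (forall z, z \in S -> X z t <= X y t) -> 1 <= g t) &
    Ex P g <= 20 / (#|S|.+1)%:R].
Proof.
move=> yS; have [S2|S2] := ltnP #|S| 2.
  exists (cst 1); split => //; first exact: bounded_meas_cst.
  rewrite Ex_cst ler_pdivlMr ?ltr0n// mul1r (ler_nat _ _ 20); lia.
(* [m] is the largest power of two at most half of [s]: [S] contains two disjoint sets of size [m],
   and [tail L] has probability [1 / m]. *)
set s := #|S|; pose L := trunc_log 2 (s %/ 2); pose m := (2 ^ L)%N.
have s2 : (0 < s %/ 2)%N by rewrite divn_gt0.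
have /andP[mle mlt] := trunc_log_bounds (isT : 1 < 2)%N s2.
rewrite -/L -/m in mle; rewrite -/L expnS -/m in mlt.
have sm : (s.+1 <= 4 * m)%N by lia.
have [Q1 Q1S Q1m] : exists2 Q : {set I}, Q \subset S & #|Q| = m.
  by apply: exists_subset_card; rewrite -/s; lia.
have [Q2 Q2S Q2m] : exists2 Q : {set I}, Q \subset (S :\: Q1)%SET & #|Q| = m.
  apply: exists_subset_card; rewrite cardsD (finset.setIidPr _) ?Q1m -/s//; lia.
have dQ : [disjoint Q1 & Q2]%B.
  rewrite disjoint_sym; apply: disjointWl Q2S _.
  by rewrite finset.disjoints_subset; apply/fintype.subsetP => i; rewrite !inE => /andP[].
have {}Q2S : Q2 \subset S by apply: fintype.subset_trans Q2S (finset.subsetDl _ _).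
have yQ1 : y \notin Q1 by apply: contra yS => /(fintype.subsetP Q1S).
have yQ2 : y \notin Q2 by apply: contra yS => /(fintype.subsetP Q2S).
pose lev j t := hit y (tail j) t * \prod_(z in S) (1 - hit z (tail j.+1) t).
have mtail j : measurable (tail j) by exact: measurable_itv.
have bhit i j : bounded_meas (hit i (tail j)) by exact: bounded_meas_hit.
have bcomp i j : bounded_meas (fun t => 1 - hit i (tail j) t).
  rewrite (_ : (fun t => _) = (fun t => 1 + -1 * hit i (tail j) t)).
    apply: bounded_measD; first exact: bounded_meas_cst.
    by apply: bounded_measM => //; exact: bounded_meas_cst.
  by apply/funext => t; rewrite mulN1r.
have blev j : bounded_meas (lev j).
  by apply: bounded_measM => //; exact: bounded_meas_prod.
exists (fun t => (1 - hit y (tail 0) t) + hit y (tail L) t + \sum_(j < L) lev j t).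
split.
- by apply: bounded_measD; [exact: bounded_measD | exact: bounded_meas_sum].
- move=> t; have h01 i j : 0 <= hit i (tail j) t <= 1.
    by case/orP: (hit01 i (tail j) t) => /eqP ->; lra.
  have slev : 0 <= \sum_(j < L) lev j t.
    apply: sumr_ge0 => j _; apply: mulr_ge0; first by case/andP: (h01 y j).
    by apply: prodr_ge0 => z _; have := h01 z j.+1; lra.
  by have := h01 y 0%N; have := h01 y L; lra.
- by move=> t; exact: layer_cover.
have m0 : 0 < m%:R :> R by rewrite ltr0n expn_gt0.
have mhalf : 2^-1 ^+ L = m%:R^-1 :> R by rewrite exprVn natrX.
(* The moment bound with [p = 2^-(j+1)] divides the probability [2^-j] of [tail j] by [(m p)^2]. *)
have levle j : (j < L)%N -> Ex P (lev j) <= 4 / m%:R ^+ 2 * 2 ^+ j.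
  move=> jL.
  have := prob_hit_miss_le y Q1 Q2 (tail j.+1) (tail j) _ (mtail j.+1)
    (mtail j) dQ yQ1 yQ2 (fun i => prob_tail i j.+1) m S Q1m Q2m Q1S Q2S.
  have c0 : 0 < (m%:R * 2^-1 ^+ j.+1) ^+ 2 :> R.
    by rewrite exprn_gt0// mulr_gt0// exprn_gt0// invr_gt0.
  rewrite mulrC -ler_pdivlMr// => /le_trans; apply.
  rewrite prob_tail !exprVn (exprS 2 j).
  have j0 : 2 ^+ j != 0 :> R by rewrite expf_neq0.
  have mn0 : m%:R != 0 :> R by rewrite gt_eqF.
  by rewrite le_eqVlt; apply/orP; left; apply/eqP; field; rewrite j0 mn0.
rewrite ExD; [|by apply: bounded_measD|exact: bounded_meas_sum].
rewrite ExD// Ex_sum//.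
have -> : Ex P (fun t => 1 - hit y (tail 0) t) = 0.
  rewrite (_ : (fun t => _) = (fun t => 1 + -1 * hit y (tail 0) t)); last first.
    by apply/funext => t; rewrite mulN1r.
  rewrite ExD; [|exact: bounded_meas_cst|]; last first.
    by apply: bounded_measM => //; exact: bounded_meas_cst.
  by rewrite Ex_cst ExZ// Ex_hit// prob_tail expr0 mulN1r subrr.
rewrite add0r Ex_hit// prob_tail mhalf.
have geo : \sum_(j < L) 2 ^+ j <= m%:R :> R.
  rewrite /m natrX; elim: (L) => [|l IH]; first by rewrite big_ord0 expr0.
  by rewrite big_ord_recr/= exprS; lra.
have sumle : \sum_(j < L) Ex P (lev j) <= 4 / m%:R.
  apply: (@le_trans _ _ (\sum_(j < L) 4 / m%:R ^+ 2 * 2 ^+ j)).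
    by apply: ler_sum => j _; exact: levle.
  rewrite -mulr_sumr; apply: (@le_trans _ _ (4 / m%:R ^+ 2 * m%:R)).
    by rewrite ler_wpM2l// divr_ge0// sqr_ge0.
  by rewrite expr2 invfM mulrA mulfVK ?gt_eqF.
(* The last tail costs [1 / m] and the layers [4 / m]; [sm] then turns [5 / m] into
   [20 / (s + 1)]. *)
apply: (@le_trans _ _ (5 / m%:R)); first by lra.
rewrite ler_pdivrMr// mulrAC ler_pdivlMr ?ltr0n// -!natrM ler_nat.
by rewrite -[20%N]/(5 * 4)%N -mulnA leq_mul.
Qed.
End Independence.

(** * Counting items by tier *)

Definition harmonic_sum (R : realType) (n : nat) : R := \sum_(i < n) (i.+1%:R)^-1.

Lemma harmonic_sum_le (R : realType) (m n : nat) : (m <= n)%N ->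
  harmonic_sum R m <= harmonic_sum R n.
Proof.
move=> /subnK <-; elim: (n - m)%N => [//|l IH].
by rewrite addSn /harmonic_sum big_ord_recr/= (le_trans IH)// lerDl invr_ge0.
Qed.

(** Each doubling of the range adds [2 ^ m] terms, none above the inverse of [2 ^ m]. *)
Lemma harmonic_sum_exp2 (R : realType) (m : nat) :
  harmonic_sum R (2 ^ m) <= m.+1%:R.
Proof.
elim: m => [|m IH]; first by rewrite /harmonic_sum big_ord1 invr1.
rewrite expnS mul2n -addnn /harmonic_sum big_split_ord/= -[in leRHS]addn1 natrD.
apply: lerD; first exact: IH.
apply: (@le_trans _ _ (\sum_(i < 2 ^ m) ((2 ^ m)%:R)^-1)).
  apply: ler_sum => i _; rewrite lef_pV2 ?posrE ?ltr0n ?expn_gt0// ler_nat.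
  by rewrite -addnS leq_addr.
by rewrite sumr_const card_ord -[leLHS]mulr_natl divff// pnatr_eq0 expn_eq0.
Qed.

(** By injectivity the ranks run through 0, ..., [#|S| - 1] once each. Removing the [f]-largest
    element leaves the other ranks unchanged, which gives the induction. *)
Lemma sum_inv_rank (R : realType) (I : finType) (f : I -> nat) (S : {set I}) :
  {in S &, injective f} ->
  \sum_(y in S) (#|[set z in S | (f z < f y)%N]|.+1%:R)^-1 =
    harmonic_sum R #|S|.
Proof.
have [m] := ubnP #|S|; elim: m S => // m IH S Sm finj.
have [->|[y0 y0S]] := set_0Vmem S.
  by rewrite big_set0 cards0 /harmonic_sum big_ord0.
have [y yS ymax] : exists2 y, y \in S & forall z, z \in S -> (f z <= f y)%N.
  by have [y yS ymax] := arg_maxnP f y0S; exists y.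
have lty z : z \in (S :\ y)%SET -> (f z < f y)%N.
  rewrite !inE => /andP[zy zS]; rewrite ltn_neqAle ymax// andbT.
  by apply: contra zy => /eqP /finj->.
have cS : #|S| = #|(S :\ y)%SET|.+1 by rewrite (cardsD1 y S) yS.
rewrite (big_setD1 y)//= addrC cS /harmonic_sum big_ord_recr/=; congr (_ + _).
  rewrite -[RHS]/(harmonic_sum R _) -IH; last 2 first.
  - by rewrite cS ltnS in Sm.
  - by move=> u v; rewrite !inE => /andP[_ uS] /andP[_ vS]; exact: finj.
  apply: eq_bigr => u /lty uy; congr ((_.+1%:R)^-1).
  apply: eq_card => z; rewrite !inE; case: eqVneq => [->|//].
  by rewrite ltnNge (ltnW uy) andbF.
congr ((_.+1%:R)^-1); apply: eq_card => z; rewrite !inE.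
apply/andP/andP => [[zS zy]|[zy zS]]; last by split=> //; apply: lty; rewrite !inE zy.
by split=> //; apply: contraTneq zy => ->; rewrite ltnn.
Qed.

Lemma log2_ltE (R : realType) (a : R) (n : nat) : 0 < a ->
  (log2 a < n%:R) = (a < 2 ^+ n).
Proof.
move=> a0; have l2 : 0 < ln 2 :> R by rewrite ln_gt0 ?ltr1n.
by rewrite /log2 ltr_pdivrMr// mulr_natl -lnXn// ltr_ln ?posrE ?exprn_gt0.
Qed.

(** * Tier sizes and the sum of the ancestor bounds *)

Section Tiers.
Context {R : realType} {n : nat}.
Variable w : 'I_n -> R.
Hypothesis hw : forall x, 0 < w x < 1.

Definition tier (x : 'I_n) : int := Num.floor (log2 (log2 (w x)^-1)).

Lemma log2_inv_gt0 x : 0 < log2 (w x)^-1.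
Proof.
have /andP[w0 w1] := hw x.
by rewrite /log2 divr_gt0 ?ln_gt0 ?ltr1n// invf_gt1.
Qed.

Lemma tier_ltE x (m : nat) : (tier x < m%:Z) = (log2 (w x)^-1 < 2 ^+ m).
Proof. by rewrite /tier floor_lt_int log2_ltE// log2_inv_gt0. Qed.

Lemma tier_lt_weight x (m : nat) : tier x < m%:Z -> (2 ^ (2 ^ m))%:R^-1 < w x.
Proof.
have /andP[w0 w1] := hw x.
rewrite tier_ltE -natrX log2_ltE ?invr_gt0// natrX => h.
by rewrite -[ltRHS]invrK ltf_pV2 ?posrE ?invr_gt0 ?exprn_gt0.
Qed.

(** Each such item weighs more than the inverse of [2 ^ (2 ^ m)], while the total weight is at most
    [2 ^ K]. *)
Lemma card_tier_lt (K m : nat) : \sum_x w x <= (2 ^ K)%:R ->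
  (#|[set x | (tier x < m%:Z)%R]%SET| <= 2 ^ (K + 2 ^ m))%N.
Proof.
move=> wK; set A := [set x | _]%SET; set e := (2 ^ 2 ^ m)%N.
have e0 : 0 < e%:R :> R by rewrite ltr0n expn_gt0.
rewrite expnD -(ler_nat R) natrM -ler_pdivrMr//.
apply: le_trans wK.
apply: (@le_trans _ _ (\sum_(x in A) w x)).
  rewrite mulr_natl -sumr_const; apply: ler_sum => x.
  by rewrite inE => /tier_lt_weight/ltW.
rewrite [leRHS](bigID (mem A))/= lerDl; apply: sumr_ge0 => x _.
by have /andP[/ltW] := hw x.
Qed.

Variables (K : nat) (x : 'I_n).
Hypothesis wK : \sum_x w x <= (2 ^ K)%:R.

(** [y] is left out, as [record_majorant] requires. Position [x] is counted only for [y] at or right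
    of it, so that the cardinals are exactly ranks by distance on each side. *)
Definition tier_between (y : 'I_n) : {set 'I_n} :=
  [set z | (tier z == tier y) &&
     (if (x <= y)%N then (x <= z < y)%N else (y < z < x)%N)]%SET.

(** Negative tiers, of weight above one half, have boundedly many items and get the trivial bound;
    an item of a tier above that of [x] is almost surely no ancestor. *)
Definition ancestor_bound (y : 'I_n) : R :=
  if tier y < 0 then 1
  else if tier x < tier y then 0 else 20 / (#|tier_between y|.+1)%:R.

Lemma tier_sum_le (t : nat) :
  \sum_(y | tier y == t%:Z) (#|tier_between y|.+1%:R)^-1
    <= 2 * (K + 2 ^ t.+1).+1%:R :> R.
Proof.
have Hle (S : {set 'I_n}) : {in S, forall z, tier z = t%:Z} ->
    harmonic_sum R #|S| <= (K + 2 ^ t.+1).+1%:R.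
  move=> St; apply: le_trans (harmonic_sum_exp2 R _).
  apply: harmonic_sum_le; apply: leq_trans (card_tier_lt K t.+1 wK).
  by apply/subset_leq_card/fintype.subsetP => z /St; rewrite inE => ->; rewrite ltz_nat.
rewrite (bigID (fun y : 'I_n => (x <= y)%N))/= mulr_natl mulr2n.
pose Sr := [set z | (tier z == t%:Z) && (x <= z)%N]%SET.
pose Sl := [set z | (tier z == t%:Z) && ~~ (x <= z)%N]%SET.
apply: lerD.
  apply: le_trans (Hle Sr _); last by move=> z; rewrite inE => /andP[/eqP].
  rewrite -(@sum_inv_rank _ _ (fun z : 'I_n => z : nat)); last first.
    by move=> u v _ _ /val_inj.
  rewrite le_eqVlt; apply/orP; left; apply/eqP.
  apply: eq_big => [y|y /andP[/eqP yt xy]]; first by rewrite inE.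
  congr ((_.+1%:R)^-1); apply: eq_card => z; rewrite !inE yt xy.
  by case: (_ == _); case: (x <= z)%N.
apply: le_trans (Hle Sl _); last by move=> z; rewrite inE => /andP[/eqP].
(* Left of [x] the order is reversed, so that ranks again grow away from [x]. *)
rewrite -(@sum_inv_rank _ _ (fun z : 'I_n => (n - z)%N)); last first.
  by move=> u v _ _ /= uv; apply: ord_inj; have := ltn_ord u; have := ltn_ord v; lia.
rewrite le_eqVlt; apply/orP; left; apply/eqP.
apply: eq_big => [y|y /andP[/eqP yt xy]]; first by rewrite inE.
congr ((_.+1%:R)^-1); apply: eq_card => z; rewrite !inE yt (negbTE xy).
rewrite -andbA; congr (_ && _).
by have := ltn_ord y; have := ltn_ord z; lia.
Qed.

Lemma sum_ancestor_bound :
  \sum_y ancestor_bound y <=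
    (2 ^ K.+1 + 40 * K.+1 + 160)%:R * Num.max 1 (log2 (w x)^-1).
Proof.
set M := Num.max _ _.
have M1 : 1 <= M by rewrite le_max lexx.
have neg_le : \sum_(y | tier y < 0) ancestor_bound y <= (2 ^ K.+1)%:R * M.
  rewrite (eq_bigr (fun=> 1)) => [|y y0]; last by rewrite /ancestor_bound y0.
  apply: (@le_trans _ _ (2 ^ K.+1)%:R); last by rewrite ler_peMr.
  rewrite sumr_const ler_nat.
  have := card_tier_lt K 0 wK; rewrite expn0 addn1; apply: leq_trans.
  by apply: subset_leq_card; apply/fintype.subsetP => y; rewrite inE.
have [tx|tx] := ltrP (tier x) 0.
  rewrite (bigID (fun y => tier y < 0))/= [X in _ + X]big1 ?addr0.
    by apply: le_trans neg_le _; rewrite ler_wpM2r ?(le_trans ler01 M1)// ler_nat; lia.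
  move=> y; rewrite /ancestor_bound -leNgt => y0.
  by rewrite ltNge y0/= (lt_le_trans tx y0).
have [tau tauE] : exists tau : nat, tier x = tau%:Z by exists `|tier x|%N; rewrite gez0_abs.
have tauM : 2 ^+ tau <= M.
  by rewrite le_max -[X in _ || X]negbK -ltNge -tier_ltE tauE ltxx orbT.
rewrite (bigID (fun y => tier y < 0))/=.
have pos_le : \sum_(y | ~~ (tier y < 0)) ancestor_bound y <=
    \sum_(t < tau.+1) 40 * (K + 2 ^ t.+1).+1%:R.
  rewrite (bigID (fun y => tier y <= tau%:Z))/= [X in _ + X]big1 ?addr0; last first.
    move=> y /andP[y0]; rewrite -ltNge /ancestor_bound (negbTE y0) tauE.
    by move=> ->.
  (* The tiers kept lie between 0 and [tau], so [inord] never falls back on its default value. *)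
  rewrite (partition_big (fun y => inord `|tier y|%N : 'I_tau.+1) predT)//=.
  apply: ler_sum => t _.
  apply: (@le_trans _ _ (20 * \sum_(y | tier y == t%:Z) (#|tier_between y|.+1%:R)^-1)).
    rewrite mulr_sumr le_eqVlt; apply/orP; left; apply/eqP; apply: eq_big => [y|y].
      rewrite -leNgt; apply/andP/eqP => [[/andP[y0 yt]] /eqP <-|yt].
        by rewrite inordK ?gez0_abs// ltnS -lez_nat gez0_abs.
      rewrite yt lez_nat -ltnS ltn_ord; split=> //.
      by apply/eqP; apply: val_inj; rewrite /= inordK.
    by move=> /andP[/andP[y0 yt] _]; rewrite /ancestor_bound (negbTE y0) tauE ltNge yt.
  by have := tier_sum_le t; lra.
have geo : \sum_(t < tau.+1) 40 * (K + 2 ^ t.+1).+1%:R <=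
    (40 * K.+1 + 160)%:R * 2 ^+ tau :> R.
  rewrite -natrX -natrM.
  rewrite (eq_bigr (fun t : 'I_tau.+1 => (40 * (K + 2 ^ t.+1).+1)%:R)); last first.
    by move=> t _; rewrite natrM.
  rewrite -natr_sum ler_nat.
  (* The factor 40 is 20 for each side of [x]. In the induction the new geometric term is
     [160 * 2 ^ l], which doubles the last summand; finally [tau.+1 <= 2 ^ tau]. *)
  suff : (\sum_(t < tau.+1) 40 * (K + 2 ^ t.+1).+1 <=
     40 * K.+1 * tau.+1 + 160 * 2 ^ tau)%N.
    by move=> /leq_trans; apply; rewrite mulnDl leq_add2r leq_mul2l ltn_expl ?orbT.
  clear; elim: tau => [|l IH]; first by rewrite big_ord1/= expn1 expn0; lia.
  rewrite big_ord_recr/=; apply: leq_trans (leq_add IH (leqnn _)) _.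
  by rewrite !expnS (mulnS _ l.+1); lia.
rewrite -addnA natrD mulrDl; apply: lerD => //.
by apply: le_trans pos_le (le_trans geo _); rewrite ler_wpM2l.
Qed.
End Tiers.

(** * Expected depth *)

Section AncestorMajorant.
Context {R : realType} {d : measure_display} {Omega : measurableType d}.
Variable P : probability Omega R.
Context {n : nat} {k : nat}.
Variables (w : 'I_n -> R) (delta : 'I_n -> {RV P >-> R}).
Hypothesis ind : kwise_independent k delta.
Hypothesis k5 : (5 <= k)%N.
Hypothesis unif : forall i, uniform01 (delta i).
Local Open Scope classical_set_scope.

Lemma priority_le y z t : priority w (fun y => delta y t) z <=
    priority w (fun y => delta y t) y ->
  (tier w y)%:~R + delta z t <= (tier w z)%:~R + delta y t.
Proof. by rewrite /priority -/(tier w y) -/(tier w z); lra. Qed.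

(** The cases follow [ancestor_bound]. Within one tier, comparing priorities means comparing
    offsets, so an ancestor is a record over [tier_between]. *)
Lemma ancestor_majorant (x y : 'I_n) :
  exists g : Omega -> R, [/\ bounded_meas g, (forall t, 0 <= g t),
    (forall t, ancestor (treap (priority w (fun y => delta y t))) y x -> 1 <= g t) &
    Ex P g <= ancestor_bound w x y].
Proof.
rewrite /ancestor_bound; have [ty0|ty0] := ltrP (tier w y) 0.
  exists (cst 1); split => //; first exact: bounded_meas_cst.
  by rewrite Ex_cst.
have [txy|tyx] := ltrP (tier w x) (tier w y); last first.
  have [|g [bg g0 g1 Eg]] := record_majorant P delta ind k5 unif (tier_between w x y) y.
    by rewrite inE; case: ifP; rewrite ltnn ?andbF.
  exists g; split=> // t anc; apply: g1 => z; rewrite inE => /andP[/eqP zy zxy].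
  have := @treap_ancestor_max _ _ _ _ _ z anc.
  have -> : (minn x y <= z <= maxn x y)%N by move: zxy; case: ifP; lia.
  by move=> /(_ isT)/priority_le; rewrite zy lerD2l.
have mpos c : measurable (`]c, +oo[ : set R) by exact: measurable_itv.
(* If [y] has the higher tier and is an ancestor, then [delta y] is at least [1 + delta x]; hence
   [delta x <= 0] or [1 < delta y], two null events whose indicators are added. *)
pose g t := (1 + -1 * hit P delta x `]0, +oo[ t) + hit P delta y `]1, +oo[ t.
have bx : bounded_meas (hit P delta x `]0, +oo[) by exact: bounded_meas_hit.
have by_ : bounded_meas (hit P delta y `]1, +oo[) by exact: bounded_meas_hit.
have bNx : bounded_meas (fun t => -1 * hit P delta x `]0, +oo[ t).
  by apply: bounded_measM => //; exact: bounded_meas_cst.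
have b1Nx : bounded_meas (fun t => 1 + -1 * hit P delta x `]0, +oo[ t).
  by apply: bounded_measD => //; exact: bounded_meas_cst.
have tailE i c t : hit P delta i `]c, +oo[ t = (c < delta i t)%R%:R.
  rewrite /hit indicE; congr (nat_of_bool _)%:R.
  by apply/idP/idP; rewrite inE/= in_itv/= andbT.
exists g; split.
- exact: bounded_measD.
- move=> t; rewrite /g !tailE.
  by case: (_ < _)%R; case: (_ < _)%R => /=; lra.
- move=> t anc; have := @treap_ancestor_max _ _ _ _ _ x anc.
  have -> : (minn x y <= x <= maxn x y)%N by lia.
  move=> /(_ isT)/priority_le.
  have : (tier w x)%:~R + 1 <= (tier w y)%:~R :> R.
    by rewrite -[1]/(1%:~R) -intrD ler_int; lia.
  rewrite /g !tailE.
  by have [] := ltrP 0 (delta x t); have [] := ltrP 1 (delta y t) => /=; lra.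
rewrite /g ExD// ExD//; last exact: bounded_meas_cst.
rewrite Ex_cst ExZ// !Ex_hit// !prob_hit_tail ?lexx ?ler01//; lra.
Qed.

Lemma expectation_depth_le (x : 'I_n) :
  ('E_P[fun t => (depth (treap (priority w (fun y => delta y t))) x)%:R]
    <= (\sum_y ancestor_bound w x y)%:E)%E.
Proof.
have [g gP] := choice (ancestor_majorant x).
have bg y : bounded_meas (g y) by have [] := gP y.
have bsum : bounded_meas (fun t => \sum_y g y t) by exact: bounded_meas_sum.
apply: (le_trans (expectation_le_Ex P _ (fun t => \sum_y g y t) _ bsum)).
  move=> t; rewrite ler0n/= /depth -sum1_card natr_sum big_mkcond/=.
  apply: ler_sum => y _; have [_ g0 g1 _] := gP y.
  by rewrite inE; case: ifP => // /g1.
rewrite lee_fin Ex_sum//; apply: ler_sum => y _.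
by have [] := gP y.
Qed.
End AncestorMajorant.

(** The maximum with 1 is natural: every depth is at least 1, while [log2 (w x)^-1] tends to 0 as
    the weight tends to 1. *)
Theorem mainTheorem1 (R : realType) (c1 c2 : R) (hc1 : 0 < c1) (hc2 : 0 < c2) :
  exists C : R, 0 < C /\
    forall (n : nat) (hn : (1 <= n)%N) (w : 'I_n -> R)
      (hw : forall x, 0 < w x < 1)
      (hw1 : c1 <= \sum_x `|w x| <= c2)
      (d : measure_display) (Omega : measurableType d) (P : probability Omega R)
      (delta : 'I_n -> {RV P >-> R})
      (hunif : forall x, uniform01 (delta x))
      (hind : kwise_independent 11 delta)
      (x : 'I_n),
      ('E_P[fun omega =>
          (depth (treap (priority w (fun y => delta y omega))) x)%:R]
        <= (C * Num.max 1 (log2 (w x)^-1))%:E)%E.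
Proof.
(* [c2 < K <= 2 ^ K], so the constant is fixed before the items, the weights and the probability
   space. *)
set K := Num.bound c2.
exists (2 ^ K.+1 + 40 * K.+1 + 160)%:R; split; first by rewrite ltr0n addn_gt0 orbT.
move=> n hn w hw /andP[_ wc2] d Omega P delta hunif hind x.
have wK : \sum_y w y <= (2 ^ K)%:R.
  rewrite (eq_bigr (fun y => `|w y|)) => [|y _]; last first.
    by rewrite ger0_norm// ltW//; case/andP: (hw y).
  apply: le_trans wc2 (le_trans (ltW (archi_boundP (ltW hc2))) _).
  by rewrite ler_nat ltnW// ltn_expl.
apply: (le_trans (expectation_depth_le P w delta hind isT hunif x)).
by rewrite lee_fin; exact: sum_ancestor_bound.
Qed.
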